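(* Let $G$ be a graph on $V=\{v_1,\dots,v_n\}$ with adjacency matrix $A$, let $S\subseteq V$ be non-empty and let $W=W^S_G$ have rank $n-2$. Let $\mathcal{G}$ be the set of all graphs $G^*$ on $V$ with $W^{S}_{G^*}=W$ and, in case $S\neq V$, with the same number of edges as $G$. (Thus, either (a) $S=V$, or (b) $S$ is arbitrary non-empty and the number of edges of $G$ is given.) Then every $G^*\in\mathcal{G}$ has the same characteristic polynomial (hence the same eigenvalues) as $G$. Let $\lambda_{n-1},\lambda_n$ be the two non-main eigenvalues of $G$ for $S$, i.e. the roots of $\det(x{\rm I}-A)/{\rm main}^S_G(x)$. (i) If $\lambda_{n-1}=\lambda_n$, then $\mathcal{G}=\{G\}$, i.e. $W$ determines the adjacency matrix of $G$. (ii) If $\lambda_{n-1}\neq\lambda_n$, then $\mathcal{G}$ contains at most two distinct graphs.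
   Context: Graphs are finite, simple, undirected; graphs on $V$ are identified with their adjacency matrices. For a graph $G$ on $V=\{v_1,\dots,v_n\}$ with adjacency matrix $A$ and non-empty $S\subseteq V$ with characteristic vector ${\rm e}\in\{0,1\}^n$, the walk matrix is $W^S_G=[{\rm e},A{\rm e},\dots,A^{n-1}{\rm e}]$. Since $A$ is real symmetric, ${\rm e}={\rm e}_1+\dots+{\rm e}_r$ uniquely with nonzero eigenvectors ${\rm e}_k$ for pairwise distinct eigenvalues $\mu_1,\dots,\mu_r$ (the main eigenvalues for $S$), and the main polynomial is ${\rm main}^S_G(x)=\prod_{k=1}^r(x-\mu_k)$; it divides the characteristic polynomial of $A$, and the remaining roots (with multiplicity) are the non-main eigenvalues. *)

(* Defs.v *)
From HB Require Import structures.
From mathcomp Require Import all_boot all_order all_algebra.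
From mathcomp Require Import spectral complex.
Set Implicit Arguments.
Unset Strict Implicit.
Unset Printing Implicit Defensive.
Import Order.TTheory GRing.Theory Num.Theory.
Local Open Scope ring_scope.

(* A graph on 'I_n is identified with its Boolean adjacency matrix, so that
   [graph n] is a finType and equality of graphs is equality of edge sets. *)
Record graph (n : nat) := Graph {
  edge : 'M[bool]_n;
  _ : (edge^T == edge) && [forall i, ~~ edge i i]
}.

HB.instance Definition _ n := [isSub for @edge n].
HB.instance Definition _ n := [Finite of graph n by <:].

Definition num_edges n (G : graph n) : nat :=
  #|[set p : 'I_n * 'I_n | (p.1 < p.2)%N && edge G p.1 p.2]|.

Section Walk.

Variables (R : nzRingType) (n : nat).

Definition adjmx (G : graph n) : 'M[R]_n := \matrix_(i, j) (edge G i j)%:R.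

Definition charvec (S : {set 'I_n}) : 'cV[R]_n := \col_i (i \in S)%:R.

Definition walk_matrix (G : graph n) (S : {set 'I_n}) : 'M[R]_n :=
  \matrix_(i, k < n) (adjmx G ^+ k *m charvec S) i 0.

Lemma adjmx_sym (G : graph n) : (adjmx G)^T = adjmx G.
Proof.
apply/matrixP => i j; rewrite !mxE.
by case: G => E /= /andP[/eqP/matrixP/(_ i j) + _]; rewrite mxE => ->.
Qed.

End Walk.

Section Main.

Variable R : rcfType.

(* [d] lists pairs (mu_k, e_k) with e = e_1 + ... + e_r, each e_k a (nonzero)
   eigenvector of A for mu_k, and the mu_k pairwise distinct. *)
Definition eigen_decomp n (A : 'M[R]_n) (e : 'cV[R]_n)
    (d : seq (R * 'cV[R]_n)) : bool :=
  [&& uniq [seq p.1 | p <- d],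
      all (fun p => (p.2 != 0) && (A *m p.2 == p.1 *: p.2)) d
    & e == \sum_(p <- d) p.2].

Lemma symmetric_diagonalizable n (A : 'M[R]_n) : A^T = A -> diagonalizable A.
Proof.
case: n A => [|n] A symA.
  by exists 1%:M; [exact: unitmx1 | apply/is_diag_mxP; case].
pose B : 'M[R[i]]_n.+1 := map_mx (real_complex R) A.
have Bher : B \is hermsymmx.
  apply: realsym_hermsym.
    apply/is_hermitianmxP; rewrite expr0 scale1r.
    by apply/matrixP => i j; rewrite !mxE -[in RHS]symA mxE.
  by apply/mxOverP => i j; rewrite mxE; apply/Creal_ImP; rewrite -complexIm.
have Breal := hermitian_spectral_diag_real Bher.
have /orthomx_spectralP BE := hermitian_normalmx Bher.
apply/diagonalizableP.
pose rs := undup [seq complex.Re (spectral_diag B 0 i) | i <- enum 'I_n.+1].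
exists rs; first exact: undup_uniq.
apply: mxminpoly_min; set p := \prod_(x <- rs) _.
apply: (@map_mx_inj _ _ (real_complex R)); rewrite map_mx0 map_horner_mx -/B.
rewrite BE horner_mx_uconjC; last exact: spectral_unit.
rewrite horner_mx_diag [X in diag_mx X](_ : _ = 0).
  by rewrite raddf0 mulmx0 mul0mx.
apply/rowP => i; rewrite !mxE.
have sE : spectral_diag B 0 i = real_complex R (complex.Re (spectral_diag B 0 i)).
  have /mxOverP/(_ 0 i)/Creal_ImP := Breal.
  by rewrite -complexIm; case: (spectral_diag B 0 i) => x y [] /= ->.
rewrite sE horner_map /= /p [X in X%:C%C](_ : _ = 0) ?rmorph0 //.
apply/eqP; rewrite -[_ == 0]/(root _ _) root_prod_XsubC mem_undup.
by apply/mapP; exists i; rewrite ?mem_enum.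
Qed.

Lemma eigen_decomp_exists n (A : 'M[R]_n) (e : 'cV[R]_n) :
  A^T = A -> exists d, eigen_decomp A e d.
Proof.
move=> symA.
have /diagonalizablePeigen[rs rsu rsP] := symmetric_diagonalizable symA.
have : (e^T <= \sum_(r <- rs) eigenspace A r)%MS by rewrite rsP submx1.
rewrite (big_nth 0) big_mkord => /sub_sumsmxP[u eE].
pose v i : 'cV[R]_n := (u i *m eigenspace A rs`_i)^T.
pose I := [seq i <- enum 'I_(size rs) | v i != 0].
exists [seq (rs`_i, v i) | i : 'I_(size rs) <- I].
apply/and3P; split.
- rewrite -map_comp map_inj_in_uniq ?filter_uniq -?enumT ?enum_uniq //.
  move=> i j _ _ /= /eqP; rewrite nth_uniq // => /eqP; exact: val_inj.
- apply/allP => _ /mapP[i + ->] /=; rewrite mem_filter => /andP[-> _] /=.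
  have /eigenspaceP vA : (u i *m eigenspace A rs`_i <= eigenspace A rs`_i)%MS.
    exact: submxMl.
  by apply/eqP; apply: trmx_inj; rewrite trmx_mul symA trmxK vA linearZ /= trmxK.
- rewrite big_map big_filter big_mkcond /= big_enum /= -[e]trmxK eE raddf_sum /=.
  by apply/eqP; apply: eq_bigr => i _; case: eqVneq.
Qed.

Definition main_decomp n (G : graph n) (S : {set 'I_n}) :
    seq (R * 'cV[R]_n) :=
  xchoose (eigen_decomp_exists (charvec R S) (adjmx_sym R G)).

(* Eigenvectors for distinct eigenvalues are independent, so [main_decomp] is
   unique up to order and [main_poly] does not depend on the choice. *)
Definition main_poly n (G : graph n) (S : {set 'I_n}) : {poly R} :=
  \prod_(p <- main_decomp G S) ('X - p.1%:P).

(* The polynomial whose roots, with multiplicity, are the non-main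
   eigenvalues. *)
Definition nonmain_poly n (G : graph n) (S : {set 'I_n}) : {poly R} :=
  char_poly (adjmx R G) %/ main_poly G S.

Definition walk_class n (G : graph n) (S : {set 'I_n}) : {set graph n} :=
  [set H | (walk_matrix R H S == walk_matrix R G S)
           && ((S != setT) ==> (num_edges H == num_edges G))].

End Main.

(* Main.v *)
Require Import Defs.
From mathcomp Require Import all_boot all_order all_algebra.
From mathcomp Require Import ring.
Set Implicit Arguments.
Unset Strict Implicit.
Unset Printing Implicit Defensive.
Import Order.TTheory GRing.Theory Num.Theory.
Local Open Scope ring_scope.

(* Let K be the column space of W, spanned by the r = n - 2 main eigenvectors
   of A = adjmx G; it has orthogonal complement K' of dimension two. If B is the
   adjacency matrix of a graph in the class then A and B agree on K, and their
   restrictions to K' have the same trace and the same trace of squares (tr A =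
   tr B = 0, and tr A^2 = tr B^2 is twice the number of edges, which for S = V is
   read off the row sums A e). Two-by-two matrices with equal such traces have
   equal characteristic polynomials.

   Moreover D = B - A is symmetric, supported on K' and has zero diagonal. As a
   quadratic form on a plane vanishing on two independent vectors is determined
   up to a scalar, D = t Z for a fixed Z, and tr A^2 = tr B^2 becomes
   t (2 tr (Z A) + t tr Z^2) = 0, so at most one t <> 0 occurs. If both non-main
   eigenvalues equal a, then A acts on K' as a, so tr (D A) = a tr D = 0 and
   hence tr D^2 = 0. *)

(** * Definiteness of the real inner product *)

Section RealMatrices.
Variable R : realDomainType.

(** The trace is the sum of the squares of the entries of [A]. *)
Lemma mxtrace_mul_trmx_eq0 m n (A : 'M[R]_(m, n)) : \tr (A *m A^T) = 0 -> A = 0.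
Proof.
have sq_ge0 i j : 0 <= A i j * A^T j i by rewrite mxE sqr_ge0.
rewrite /mxtrace; under eq_bigr do rewrite mxE.
move=> /psumr_eq0P trA0; apply/matrixP => i j; rewrite [RHS]mxE.
have /psumr_eq0P rowA0 := trA0 (fun i _ => sumr_ge0 _ (fun j _ => sq_ge0 i j)) i isT.
have /eqP := rowA0 (fun j _ => sq_ge0 i j) j isT.
by rewrite mxE mulf_eq0 orbb => /eqP.
Qed.

Lemma mulmx_trmx_eq0 m n (A : 'M[R]_(m, n)) : A *m A^T = 0 -> A = 0.
Proof. by move=> A0; apply: mxtrace_mul_trmx_eq0; rewrite A0 mxtrace0. Qed.

End RealMatrices.

(** * Orthogonal complements and invariant subspaces *)

Section OrthogonalFrames.
Variable R : realFieldType.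

(** Pairing a relation [u *m E + w *m N = 0] with [w *m N] removes the [E] part and leaves the
    squared norm of [w *m N]. *)
Lemma row_free_col_mx_orthogonal r k n (E : 'M[R]_(r, n)) (N : 'M[R]_(k, n)) :
  row_free E -> row_free N -> E *m N^T = 0 -> row_free (col_mx E N).
Proof.
move=> Efree Nfree EN; apply: inj_row_free => v.
rewrite -[v]hsubmxK mul_row_col; set u := lsubmx v; set w := rsubmx v => uw0.
have wN0 : w *m N = 0.
  apply: mulmx_trmx_eq0.
  have /(congr1 (fun X => X *m N^T *m w^T)) := uw0.
  by rewrite mulmxDl -[u *m E *m N^T]mulmxA EN mulmx0 add0r !mul0mx trmx_mul !mulmxA.
have w0 : w = 0 by apply: (row_free_inj Nfree); rewrite wN0 mul0mx.
have u0 : u = 0.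
  by apply: (row_free_inj Efree); rewrite -[LHS]addr0 -wN0 uw0 mul0mx.
by rewrite w0 u0 row_mx0.
Qed.

(** Any basis of the complement has [k] independent columns; multiplying by the inverse of that
    minor makes it the identity. Coordinates with respect to [N] can then be read off the columns
    picked by [f]. *)
Lemma orthogonal_complement_frame r k n (E : 'M[R]_(r, n)) :
  (r + k = n)%N -> row_free E ->
  exists (N : 'M[R]_(k, n)) (f : 'I_k -> 'I_n),
    [/\ (N :=: kermx E^T)%MS, row_free N & colsub f N = 1%:M].
Proof.
move=> rk Efree.
have rankK : \rank (kermx E^T) = k.
  by rewrite mxrank_ker mxrank_tr (eqP Efree) -rk addKn.
have [N0 N0K] : exists N0 : 'M[R]_(k, n), (N0 :=: kermx E^T)%MS.
  by rewrite -rankK; exists (row_base (kermx E^T)); exact: eq_row_base.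
have N0full : row_full N0^T by rewrite /row_full mxrank_tr N0K rankK.
pose f := fullrankfun N0full; pose P := rowsub f N0^T.
have Punit : P \in unitmx by exact: fullrowsub_unit.
have NN0 : (invmx P^T *m N0 :=: N0)%MS.
  by apply: eqmxMfull; rewrite row_full_unit unitmx_inv unitmx_tr.
exists (invmx P^T *m N0), f; split; first exact: eqmx_trans NN0 N0K.
  by rewrite /row_free NN0 N0K rankK.
rewrite mxsub_mul mxsub_id -[colsub f N0]trmxK trmx_mxsub.
by rewrite mulVmx ?unitmx_tr.
Qed.

(** A symmetric matrix preserving the row space of [E] also preserves its orthogonal complement; [M]
    is the matrix of the restriction. *)
Lemma symmetric_restriction r k n (A : 'M[R]_n) (E : 'M[R]_(r, n)) L
    (N : 'M[R]_(k, n)) :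
  A^T = A -> E *m A = L *m E -> (N :=: kermx E^T)%MS ->
  exists M, N *m A = M *m N.
Proof.
move=> symA EA NK; apply/submxP; rewrite NK; apply/sub_kermxP.
rewrite -[in LHS]symA -mulmxA -trmx_mul EA trmx_mul mulmxA.
suff -> : N *m E^T = 0 by rewrite mul0mx.
by apply/sub_kermxP; rewrite NK.
Qed.

End OrthogonalFrames.

(** * Splitting along two complementary invariant subspaces *)

Section BlockDiagonalization.
Variables (F : fieldType) (r k : nat) (A : 'M[F]_(r + k)).
Variables (E : 'M[F]_(r, r + k)) (N : 'M[F]_(k, r + k)).
Variables (L : 'M[F]_r) (M : 'M[F]_k).
Hypotheses (EN_unit : col_mx E N \in unitmx).
Hypotheses (EA : E *m A = L *m E) (NA : N *m A = M *m N).

Let block_conj : col_mx E N *m A = block_mx L 0 0 M *m col_mx E N.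
Proof. by rewrite mul_col_mx EA NA mul_block_col !mul0mx addr0 add0r. Qed.

Lemma char_poly_block_conj : char_poly A = char_poly L * char_poly M.
Proof.
rewrite /char_poly -[_ * _](det_ublock _ 0) -char_block_diag_mx.
set P := map_mx polyC (col_mx E N).
have detP : \det P != 0.
  by rewrite det_map_mx polyC_eq0 -unitfE -unitmxE.
(* Cancelling the nonzero constant [\det P] avoids inverting [P] over the polynomial ring. *)
apply: (mulfI detP); rewrite [RHS]mulrC -!det_mulmx; congr (\det _).
rewrite /char_poly_mx mulmxBr mulmxBl -!map_mxM block_conj.
by rewrite scalar_mxC.
Qed.

Lemma mxtrace_block_conj : \tr A = \tr L + \tr M.
Proof.
rewrite -(mxtrace_block L 0 0 M) -[A](mulKmx EN_unit) block_conj.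
by rewrite mxtrace_mulC mulmxK.
Qed.

End BlockDiagonalization.

(** * Traces and characteristic polynomials in dimension two *)

Section TwoByTwo.
Variable F : fieldType.
Implicit Type M : 'M[F]_2.

Lemma char_poly2 M : char_poly M = 'X^2 - (\tr M) *: 'X + (\det M)%:P.
Proof.
apply/polyP => -[|[|[|i]]].
- by rewrite char_poly_det expr2 mulrNN !mul1r !coefE /= mulr0 subr0 add0r.
- by rewrite char_poly_trace // !coefE /= mulr1 add0r addr0.
- have := char_poly_monic M; rewrite monicE lead_coefE size_char_poly => /eqP ->.
  by rewrite !coefE /= mulr0 subr0 addr0.
- by rewrite nth_default ?size_char_poly // !coefE /= mulr0 subr0 addr0.
Qed.

(** This is the trace of the Cayley-Hamilton identity, the identity matrix having trace 2. *)
Lemma mxtrace_sqr2 M : \tr (M *m M) = (\tr M) ^+ 2 - (\det M) *+ 2.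
Proof.
have := Cayley_Hamilton M; rewrite char_poly2 rmorphD rmorphB /= linearZ /=.
rewrite rmorphXn /= horner_mx_X horner_mx_C expr2 => /(congr1 mxtrace).
rewrite !(mxtraceD, raddfN, mxtraceZ, mxtrace0, mxtrace_scalar) /=.
rewrite -mulmxE => /eqP; rewrite -addrA addr_eq0 opprD opprK => /eqP ->.
by rewrite mxtraceZ.
Qed.

(** The two traces determine only twice the determinant, hence the condition on 2. *)
Lemma char_poly2_eq M M' : (2%:R : F) != 0 ->
  \tr M = \tr M' -> \tr (M *m M) = \tr (M' *m M') -> char_poly M = char_poly M'.
Proof.
move=> two_neq0 trMM'; rewrite !mxtrace_sqr2 !char_poly2 trMM' => /addrI/oppr_inj.
by rewrite -!(mulr_natr (\det _)) => /(mulIf two_neq0) ->.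
Qed.

End TwoByTwo.

(** * Frames of main eigenvectors, stored as rows *)

Section EigenFrames.
Variables (R : rcfType) (n : nat).
Implicit Types (A : 'M[R]_n) (e : 'cV[R]_n).

(** Symmetry of [A] makes the Gram matrix [E *m E^T] commute with [diag_mx mu]; as the [mu 0 j] are
    distinct, the rows are orthogonal, hence independent. *)
Lemma row_free_eigenvectors r A (mu : 'rV[R]_r) (E : 'M[R]_(r, n)) :
  A^T = A -> E *m A = diag_mx mu *m E -> injective (mu 0) ->
  (forall k, row k E != 0) -> row_free E.
Proof.
move=> symA EA mu_inj E_neq0; apply: inj_row_free => v vE0.
have comm : diag_mx mu *m (E *m E^T) = E *m E^T *m diag_mx mu.
  rewrite mulmxA -EA -{1}symA -[in LHS]mulmxA -trmx_mul EA trmx_mul tr_diag_mx.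
  by rewrite mulmxA.
have ortho j k : j != k -> (E *m E^T) j k = 0.
  move=> jk; have := congr1 (fun X : 'M_r => X j k) comm.
  rewrite mul_diag_mx mul_mx_diag mxE [in RHS]mxE [RHS]mulrC => /eqP.
  rewrite -subr_eq0 -mulrBl mulf_eq0 subr_eq0 => /orP[/eqP/mu_inj jk0|/eqP //].
  by rewrite jk0 eqxx in jk.
apply/rowP => k; rewrite [RHS]mxE.
have : (v *m (E *m E^T)) 0 k = 0 by rewrite mulmxA vE0 mul0mx mxE.
rewrite mxE (bigD1 k) //= big1 ?addr0; last first.
  by move=> j jk; rewrite ortho ?mulr0.
move/eqP; rewrite mulf_eq0 => /orP[/eqP // | /eqP Ekk0].
case/eqP: (E_neq0 k); apply: mulmx_trmx_eq0.
apply/matrixP => i j; rewrite !ord1 [RHS]mxE -[RHS]Ekk0 !mxE.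
by apply: eq_bigr => l _; rewrite !mxE.
Qed.

Lemma eigen_decomp_frame A e d : A^T = A -> eigen_decomp A e d ->
  exists (mu : 'rV[R]_(size d)) (E : 'M[R]_(size d, n)),
    [/\ injective (mu 0), row_free E, E *m A = diag_mx mu *m E,
        e^T = const_mx 1 *m E
      & \prod_(p <- d) ('X - p.1%:P) = char_poly (diag_mx mu)].
Proof.
move=> symA /and3P[d_uniq /allP d_eigen /eqP eE].
pose x0 : R * 'cV[R]_n := (0, 0).
pose mu : 'rV[R]_(size d) := \row_k (nth x0 d k).1.
pose E := \matrix_(k < size d) (nth x0 d k).2^T.
have mu_inj : injective (mu 0).
  move=> j k; rewrite !mxE -!(nth_map x0 0) // => /eqP.
  by rewrite nth_uniq ?size_map // => /eqP/val_inj.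
have EA : E *m A = diag_mx mu *m E.
  apply/row_matrixP => k; rewrite !row_mul row_diag_mx -scalemxAl -rowE mxE !rowK.
  have /andP[_ /eqP Av] := d_eigen _ (mem_nth x0 (ltn_ord k)).
  by rewrite -[in LHS]symA -trmx_mul Av linearZ.
exists mu, E; split=> //.
- apply: row_free_eigenvectors EA mu_inj _ => // k.
  have /andP[v0 _] := d_eigen _ (mem_nth x0 (ltn_ord k)).
  by rewrite rowK trmx_eq0.
- rewrite eE (big_nth x0) big_mkord raddf_sum mulmx_sum_row.
  by apply: eq_bigr => k _; rewrite mxE scale1r rowK.
- rewrite char_poly_trig ?diag_mx_is_trig // (big_nth x0) big_mkord.
  by apply: eq_bigr => k _; rewrite !mxE eqxx.
Qed.

(** In the eigenvector frame the walk vectors are the rows of a Vandermonde matrix. *)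
Lemma krylov_eigen_coordinates r A e (mu : 'rV[R]_r) (E : 'M[R]_(r, n)) k :
  A^T = A -> E *m A = diag_mx mu *m E -> e^T = const_mx 1 *m E ->
  (A ^+ k *m e)^T = (\row_j mu 0 j ^+ k) *m E.
Proof.
move=> symA EA eE; elim: k => [|k IHk].
  rewrite expr0 mul1mx eE; congr (_ *m _); apply/rowP => j.
  by rewrite !mxE expr0.
rewrite exprS -mulmxE -mulmxA trmx_mul symA IHk -mulmxA EA mulmxA.
congr (_ *m _); apply/rowP => j; rewrite mul_mx_diag !mxE.
by rewrite exprSr.
Qed.

End EigenFrames.

(** * Adjacency matrices, walk matrices and the class *)

Section Graphs.
Variables (R : rcfType) (n : nat).
Implicit Types (G H : graph n) (S : {set 'I_n}).

Lemma edge_sym G i j : edge G i j = edge G j i.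
Proof. by case: G => M /= /andP[/eqP/matrixP/(_ i j) + _]; rewrite mxE. Qed.

Lemma edge_irrefl G i : edge G i i = false.
Proof. by case: G => M /= /andP[_ /forallP/(_ i)/negbTE]. Qed.

Lemma adjmx_inj : injective (@adjmx R n).
Proof.
move=> G H /matrixP GH; apply/val_inj/matrixP => i j /=.
have := GH i j; rewrite !mxE => /eqP; rewrite eqr_nat.
by case: (edge G i j); case: (edge H i j).
Qed.

Lemma adjmx_diag G i : adjmx R G i i = 0.
Proof. by rewrite mxE edge_irrefl. Qed.

Lemma mxtrace_adjmx G : \tr (adjmx R G) = 0.
Proof. by apply: big1 => i _; apply: adjmx_diag. Qed.

Lemma mxtrace_adjmx_sqr G :
  \tr (adjmx R G *m adjmx R G) = \sum_i \sum_j adjmx R G i j.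
Proof.
apply: eq_bigr => i _; rewrite mxE; apply: eq_bigr => j _.
by rewrite !mxE edge_sym -natrM mulnb andbb.
Qed.

(** Each edge is counted once in each direction. *)
Lemma sum_adjmx G : \sum_i \sum_j adjmx R G i j = (num_edges G).*2%:R.
Proof.
have -> : num_edges G = (\sum_(i < n) \sum_(j < n) ((i < j) && edge G i j))%N.
  rewrite /num_edges cardsE -sum1_card pair_big /= big_mkcond /=.
  by apply: eq_bigr => p _; rewrite unfold_in; case: ifP.
rewrite -addnn [X in (_ + X)%N]exchange_big /= -big_split /= natr_sum.
apply: eq_bigr => i _; rewrite -big_split natr_sum; apply: eq_bigr => j _ /=.
rewrite mxE (edge_sym G j i); congr _%:R.
case: ltngtP => [||/val_inj ->]; rewrite ?edge_irrefl ?addn0 ?add0n //=.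
Qed.

Lemma walk_matrix_same_walk G H S k :
  walk_matrix R H S = walk_matrix R G S -> (k < n)%N ->
  adjmx R H ^+ k *m charvec R S = adjmx R G ^+ k *m charvec R S.
Proof.
move=> /matrixP WHG kn; apply/colP => i.
by have := WHG i (Ordinal kn); rewrite !mxE.
Qed.

(** Both traces are sums of all entries. For [S = setT] the column of index 1 of the walk matrix
    lists the row sums, and [1 < n] ensures that it exists; otherwise the edge counts agree. *)
Lemma walk_class_mxtrace_sqr G H S : (1 < n)%N -> H \in walk_class R G S ->
  \tr (adjmx R H *m adjmx R H) = \tr (adjmx R G *m adjmx R G).
Proof.
move=> n_gt1; rewrite inE !mxtrace_adjmx_sqr => /andP[/eqP WHG].
have [ST _|_ /eqP edgeHG] := eqVneq S setT; last by rewrite !sum_adjmx edgeHG.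
apply: eq_bigr => i _.
have := congr1 (fun v : 'cV_n => v i 0) (walk_matrix_same_walk WHG n_gt1).
have rowsumE K : (adjmx R K ^+ 1 *m charvec R S) i 0 = \sum_j adjmx R K i j.
  by rewrite expr1 mxE; apply: eq_bigr => j _; rewrite [charvec _ _ _ _]mxE ST inE mulr1.
by rewrite !rowsumE.
Qed.

(** The Vandermonde matrix of the distinct main eigenvalues is invertible, so the first [r] walk
    vectors span the same space as the main eigenvectors. A matrix with the same walks therefore
    acts on that space as [adjmx R G] does. *)
Lemma main_frame G S :
  exists r (mu : 'rV[R]_r) (E : 'M[R]_(r, n)),
    [/\ r = \rank (walk_matrix R G S), row_free E,
        E *m adjmx R G = diag_mx mu *m E, main_poly R G S = char_poly (diag_mx mu)
      & forall H, (r < n)%N -> walk_matrix R H S = walk_matrix R G S ->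
          E *m adjmx R H = E *m adjmx R G].
Proof.
set A := adjmx R G; have symA : A^T = A := adjmx_sym R G.
rewrite /main_poly; set d := main_decomp R G S.
have d_decomp : eigen_decomp A (charvec R S) d by exact: xchooseP.
have [mu [E [mu_inj Efree EA eE pE]]] := eigen_decomp_frame symA d_decomp.
set r := size d in mu E mu_inj Efree EA eE pE.
have walkE := krylov_eigen_coordinates _ symA EA eE.
have Vunit : Vandermonde r mu \in unitmx.
  rewrite unitmxE unitfE det_Vandermonde; apply/prodf_neq0 => i _.
  apply/prodf_neq0 => j ij; rewrite subr_eq0; apply/eqP => /mu_inj ji.
  by rewrite ji ltnn in ij.
have rowVE k : row k (Vandermonde r mu *m E) = (A ^+ k *m charvec R S)^T.
  by rewrite walkE row_mul; congr (_ *m E); apply/rowP => j; rewrite !mxE.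
have VE : (Vandermonde r mu *m E :=: E)%MS.
  by apply: eqmxMfull; rewrite row_full_unit.
have rn : (r <= n)%N by rewrite -(eqP Efree) rank_leq_col.
have rowW k : row k (walk_matrix R G S)^T = (A ^+ k *m charvec R S)^T.
  by apply/rowP => i; rewrite !mxE.
have WE : ((walk_matrix R G S)^T :=: E)%MS.
  apply/eqmxP/andP; split.
    by apply/row_subP => k; rewrite rowW walkE submxMl.
  rewrite -VE; apply/row_subP => k.
  by rewrite rowVE -(rowW (widen_ord rn k)) row_sub.
exists r, mu, E; split=> //; first by rewrite -mxrank_tr WE (eqP Efree).
move=> H r_lt_n WHG.
(* The action on walk vector [k] is walk vector [k.+1], which must still be a column of the walk
   matrix; this uses [r < n]. *)
have rn' (k : 'I_r) : (k.+1 < n)%N by apply: leq_ltn_trans r_lt_n.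
(* Multiplying by the Vandermonde matrix replaces eigenvectors by walk vectors. *)
apply: (can_inj (mulKmx Vunit)); rewrite !mulmxA; apply/row_matrixP => k.
rewrite [LHS]row_mul [RHS]row_mul rowVE.
rewrite -{1}(walk_matrix_same_walk WHG (ltnW (rn' k))).
rewrite -[adjmx R H in X in _ *m X = _]adjmx_sym -[A in X in _ = _ *m X]symA.
rewrite -!trmx_mul !mulmxA mulmxE -!exprS.
by rewrite (walk_matrix_same_walk WHG (rn' k)).
Qed.

End Graphs.

(* D = N^T X N where X is the block of D on the rows and columns picked by f;
   the zero diagonal leaves X only its off-diagonal entry. *)
Lemma zero_diag_symmetric_line (F : fieldType) n (N : 'M[F]_(2, n))
    (f : 'I_2 -> 'I_n) (D : 'M[F]_n) :
  colsub f N = 1%:M -> (D <= N)%MS -> D^T = D -> (forall i, D i i = 0) ->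
  D = D (f 0) (f 1) *: (N^T *m (const_mx 1 - 1%:M) *m N).
Proof.
move=> fN /submxP[X DX] symD D0.
have DE : D = colsub f D *m N.
  by rewrite {2}DX mxsub_mul mxsub_id fN mulmx1.
have XT : X^T = mxsub f f D *m N.
  have XE : X = colsub f D by rewrite DX mxsub_mul mxsub_id fN mulmx1.
  rewrite XE trmx_mxsub symD {1}DE -mul_rowsub_mx; congr (_ *m N).
  by apply/matrixP => i j; rewrite !mxE.
rewrite {1}DX -[X]trmxK XT trmx_mul scalemxAl scalemxAr.
congr (_ *m _ *m _); apply/matrixP => i j; rewrite !mxE.
have D10 : D (f 1) (f 0) = D (f 0) (f 1) by rewrite -{1}symD mxE.
have ord2 (k : 'I_2) : k = 0 \/ k = 1.
  by case: k => [[|[|k]] kP] //; [left | right]; apply: val_inj.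
by case: (ord2 i) => ->; case: (ord2 j) => ->;
  rewrite ?D0 ?D10 /= ?subrr ?subr0 ?mulr0 ?mulr1.
Qed.

(** Cayley-Hamilton gives nilpotency only; for a symmetric matrix it will force the restriction to
    be scalar. *)
Lemma char_poly_double_root (F : fieldType) (M : 'M[F]_2) a :
  char_poly M = ('X - a%:P) ^+ 2 -> (M - a%:M) *m (M - a%:M) = 0.
Proof.
move=> charM; have := Cayley_Hamilton M.
by rewrite charM rmorphXn rmorphB /= horner_mx_X horner_mx_C expr2.
Qed.

(** * Cospectrality and the size of the class *)

Theorem theorem5p6 (R : rcfType) (n : nat) (G : graph n) (S : {set 'I_n})
    (S_neq0 : S != set0)
    (rankW : (\rank (walk_matrix R G S) + 2 = n)%N) :
  (forall H : graph n, H \in walk_class R G S ->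
     char_poly (adjmx R H) = char_poly (adjmx R G)
     /\ eigenvalue (adjmx R H) =1 eigenvalue (adjmx R G)) /\
  (forall a b : R, nonmain_poly R G S = ('X - a%:P) * ('X - b%:P) ->
     (a = b -> walk_class R G S = [set G]) /\
     (a != b -> (#|walk_class R G S| <= 2)%N)).
Proof.
have [r [mu [E [rE Efree EA mainE classEA]]]] := main_frame R G S.
rewrite -{}rE in rankW.
have [N [f [NK Nfree fN]]] := orthogonal_complement_frame rankW Efree.
have EN : E *m N^T = 0.
  by apply: trmx_inj; rewrite trmx_mul trmxK trmx0; apply/sub_kermxP; rewrite NK.
subst n; set A := adjmx R G in EA *; set L := diag_mx mu in EA mainE *.
have symA : A^T = A := adjmx_sym R G.
have Punit : col_mx E N \in unitmx.
  by rewrite -row_free_unit row_free_col_mx_orthogonal.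
have n_gt1 : (1 < r + 2)%N by rewrite addn2.
have classE H : H \in walk_class R G S -> E *m adjmx R H = E *m A.
  by rewrite inE => /andP[/eqP WHG _]; apply: classEA; rewrite // addn2 ltnS.
(* Squares respect the same splitting, so the block trace formula also applies to [A *m A]. *)
have sqr_conj k (F : 'M[R]_(k, r + 2)) B X :
    F *m B = X *m F -> F *m (B *m B) = X *m X *m F.
  by move=> FB; rewrite mulmxA FB -!mulmxA FB.
have [M NA] := symmetric_restriction symA EA NK.
split=> [H HG | a b].
  set B := adjmx R H; have EB : E *m B = L *m E by rewrite -EA classE.
  have [M' NB] := symmetric_restriction (adjmx_sym R H) EB NK.
  have charBA : char_poly B = char_poly A.
    rewrite (char_poly_block_conj Punit EB NB) (char_poly_block_conj Punit EA NA).
    congr (_ * _); apply: char_poly2_eq; first by rewrite pnatr_eq0.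
      (* The block [L] is common to both graphs, so its trace can be cancelled. *)
      apply: (addrI (\tr L)); rewrite -(mxtrace_block_conj Punit EB NB).
      by rewrite -(mxtrace_block_conj Punit EA NA) !mxtrace_adjmx.
    apply: (addrI (\tr (L *m L))).
    rewrite -(mxtrace_block_conj Punit (sqr_conj _ _ _ _ EB) (sqr_conj _ _ _ _ NB)).
    rewrite -(mxtrace_block_conj Punit (sqr_conj _ _ _ _ EA) (sqr_conj _ _ _ _ NA)).
    exact: walk_class_mxtrace_sqr n_gt1 HG.
  by split=> // x; rewrite !eigenvalue_root_char charBA.
have GG : G \in walk_class R G S by rewrite inE !eqxx implybT.
have diffN H : H \in walk_class R G S -> (adjmx R H - A <= N)%MS.
  move=> HG; rewrite NK; apply/sub_kermxP.
  rewrite -[_ - A]trmxK -trmx_mul raddfB /= !adjmx_sym mulmxBr (classE _ HG).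
  by rewrite subrr trmx0.
have diff_sym H : (adjmx R H - A)^T = adjmx R H - A by rewrite raddfB /= !adjmx_sym.
have diff_tr H : H \in walk_class R G S -> let D := adjmx R H - A in
    \tr (D *m A) *+ 2 + \tr (D *m D) = 0.
  move=> HG D; have := walk_class_mxtrace_sqr n_gt1 HG.
  have -> : adjmx R H = D + A by rewrite subrK.
  clearbody D; rewrite -/A mulmxDl !mulmxDr !mxtraceD (mxtrace_mulC A D).
  by move/eqP; rewrite -subr_eq0 => /eqP <-; ring.
(* The main polynomial is the characteristic polynomial of [L], so the quotient is that of [M]. *)
rewrite /nonmain_poly -/A (char_poly_block_conj Punit EA NA) -mainE mulKp; last first.
  by rewrite mainE monic_neq0 ?char_poly_monic.
move=> charM; split=> [ab | _].
  have NAa : N *m (A - a%:M) = (M - a%:M) *m N.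
    by rewrite mulmxBr mulmxBl NA scalar_mxC.
  have Aa_sym : (A - a%:M)^T = A - a%:M by rewrite raddfB /= symA tr_scalar_mx.
  have NAa0 : N *m (A - a%:M) = 0.
    (* The Gram matrix of [N *m (A - a%:M)] is the square of [M - a%:M] times [N *m N^T], hence
       zero. *)
    apply: mulmx_trmx_eq0; rewrite trmx_mul Aa_sym.
    rewrite mulmxA NAa -(mulmxA (M - a%:M)) NAa !mulmxA.
    by rewrite char_poly_double_root ?mul0mx // charM -ab expr2.
  apply/setP => H; rewrite in_set1; apply/idP/eqP => [HG | -> //].
  apply: (@adjmx_inj R); apply/eqP; rewrite -subr_eq0 -/A; apply/eqP.
  have := diff_tr H HG; have /submxP[X DX] := diffN H HG; move=> /=.
  have -> : (adjmx R H - A) *m A = a *: (adjmx R H - A).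
    apply/eqP; rewrite -mul_mx_scalar -subr_eq0 -mulmxBr {1}DX -mulmxA NAa0.
    by rewrite mulmx0.
  rewrite mxtraceZ raddfB /= !mxtrace_adjmx subrr mulr0 mul0rn add0r.
  by rewrite -{2}diff_sym => /mxtrace_mul_trmx_eq0.
set Z := N^T *m (const_mx 1 - 1%:M) *m N.
have Z_sym : Z^T = Z.
  by rewrite !trmx_mul trmxK raddfB /= tr_scalar_mx trmx_const mulmxA.
have diffZ H : H \in walk_class R G S -> H != G ->
    exists2 t, adjmx R H - A = t *: Z &
      \tr (Z *m Z) != 0 /\ t * \tr (Z *m Z) = - (\tr (Z *m A) *+ 2).
  move=> HG H_neq; set D := adjmx R H - A.
  have D_neq0 : D != 0.
    by rewrite subr_eq0; apply: contraNneq H_neq => /adjmx_inj ->.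
  have [t DZ] : exists t, D = t *: Z.
    exists (D (f 0) (f 1)); apply: zero_diag_symmetric_line.
    - exact: fN.
    - exact: diffN.
    - exact: diff_sym.
    - by move=> i; rewrite mxE [X in _ + X]mxE !adjmx_diag subrr.
  exists t => //; have /andP[t_neq0 Z_neq0] : (t != 0) && (Z != 0).
    by rewrite -negb_or -scalemx_eq0 -DZ.
  (* As [Z] is symmetric and nonzero, its square has nonzero trace. Cancelling [t] from the
     quadratic trace identity leaves a linear equation for [t]. *)
  split; first by apply: contraNneq Z_neq0; rewrite -{2}Z_sym => /mxtrace_mul_trmx_eq0 ->.
  have := diff_tr H HG; rewrite /= -/D DZ -!scalemxAl -scalemxAr !mxtraceZ.
  rewrite -mulrnAr -mulrDr => /eqP; rewrite mulf_eq0 (negPf t_neq0) /=.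
  by rewrite addrC addr_eq0 => /eqP.
(* Once some [H] other than [G] is in the class, the linear equation gives every other such graph
   the same scalar, so it equals [H]. *)
have [sub1 | /subsetPn[H HG H_neq]] := boolP (walk_class R G S \subset [set G]).
  by apply: leq_trans (subset_leq_card sub1) _; rewrite cards1.
suff sub2 : walk_class R G S \subset [set G; H].
  by apply: leq_trans (subset_leq_card sub2) _; rewrite cards2; case: eqP.
apply/subsetP => K KG; rewrite in_set2; have [//|K_neq /=] := eqVneq K G.
rewrite in_set1 in H_neq.
have [t HZ [ZZ tZ]] := diffZ H HG H_neq; have [u KZ [_ uZ]] := diffZ K KG K_neq.
apply/eqP/(@adjmx_inj R)/(addIr (- A)); rewrite HZ KZ; congr (_ *: _).
by apply: (mulIf ZZ); rewrite uZ tZ.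
Qed.
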